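(* Let $\mathsf{C}$ be a strict braided monoidal category that admits equalizers and let $\mathbb{H}=(H_1,H_2,\sigma_H)$ be a Hopf truss in $\mathsf{C}$. The induction functor $\mathsf{F}=H\otimes-:\mathsf{C}\to\mathbb{H}\text{-}\mathsf{Hopf\text{-}Mod}$ is left adjoint to the functor of coinvariants $\mathsf{W}=(\;\;)^{co\mathbb{H}}:\mathbb{H}\text{-}\mathsf{Hopf\text{-}Mod}\to\mathsf{C}$, and they induce a categorical equivalence between $\mathbb{H}\text{-}\mathsf{Hopf\text{-}Mod}$ and $\mathsf{C}$.
   Context: **Conventions.** $(\mathsf{C},\otimes,K,c)$ is a strict braided monoidal category with unit object $K$ and braiding $c$, admitting equalizers. For an object $P$ and a morphism $f$, $P\otimes f$ and $f\otimes P$ mean $id_P\otimes f$ and $f\otimes id_P$. Monoids $(A,\eta_A,\mu_A)$ (unit, product) and comonoids $(D,\varepsilon_D,\delta_D)$ (counit, coproduct) and their morphisms are the usual (co)associative (co)unital ones; left modules over a monoid and left comodules over a comonoid are the usual (co)unital ones. For comonoids $D,E$, $D\otimes E$ is a comonoid with $\varepsilon_{D\otimes E}=\varepsilon_D\otimes\varepsilon_E$, $\delta_{D\otimes E}=(D\otimes c_{D,E}\otimes E)\circ(\delta_D\otimes\delta_E)$. **Bimonoids, Hopf monoids.** A non-unital bimonoid is a comonoid $(B,\varepsilon_B,\delta_B)$ with an associative product $\mu_B:B\otimes B\to B$ (no unit required) that is a comonoid morphism. A bimonoid is an object that is a monoid and a comonoid such that unit and product are comonoid morphisms; a Hopf monoid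 is a bimonoid $H$ with an antipode $\lambda_H:H\to H$, i.e. $\mu_H\circ(H\otimes\lambda_H)\circ\delta_H=\eta_H\circ\varepsilon_H=\mu_H\circ(\lambda_H\otimes H)\circ\delta_H$. For a non-unital bimonoid $B$, a non-unital left $B$-module is $(M,\phi_M)$ with $\phi_M:B\otimes M\to M$ satisfying $\phi_M\circ(B\otimes\phi_M)=\phi_M\circ(\mu_B\otimes M)$. **Hopf trusses.** A Hopf truss $\mathbb{H}=(H_1,H_2,\sigma_H)$ in $\mathsf{C}$ consists of a comonoid $(H,\varepsilon_H,\delta_H)$ together with $\eta_H,\mu_H^1,\mu_H^2,\lambda_H,\sigma_H$ such that $H_1=(H,\eta_H,\mu_H^1,\varepsilon_H,\delta_H,\lambda_H)$ is a Hopf monoid, $H_2=(H,\mu_H^2,\varepsilon_H,\delta_H)$ is a non-unital bimonoid, $\sigma_H:H\to H$ is a comonoid morphism, and $$\mu_H^2\circ(H\otimes\mu_H^1)=\mu_H^1\circ(\mu_H^2\otimes\Gamma_{H_1}^{\sigma_H})\circ(H\otimes c_{H,H}\otimes H)\circ(\delta_H\otimes H\otimes H),$$ where $\Gamma_{H_1}^{\sigma_H}=\mu_H^1\circ((\lambda_H\circ\sigma_H)\otimes\mu_H^2)\circ(\delta_H\otimes H)$. **Modules over a Hopf truss.** A left $\mathbb{H}$-module is a triple $(M,\psi_M^1,\psi_M^2)$ where $(M,\psi_M^1)$ is a left $H_1$-module, $(M,\psi_M^2)$ is a non-unital left $H_2$-module and $$\psi_M^2\circ(H\otimes\psi_M^1)=\psi_M^1\circ(\mu_H^2\otimes\Gamma_M^{\sigma_H})\circ(H\otimes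 c_{H,H}\otimes M)\circ(\delta_H\otimes H\otimes M),$$ with $\Gamma_M^{\sigma_H}=\psi_M^1\circ((\lambda_H\circ\sigma_H)\otimes\psi_M^2)\circ(\delta_H\otimes M)$. Morphisms are morphisms of $\mathsf{C}$ linear for both actions. **Hopf modules.** For a (non-unital) bimonoid $B$, a (non-unital) left $B$-Hopf module is a triple $(M,\varphi_M,\rho_M)$ with $(M,\varphi_M)$ a (non-unital) left $B$-module, $(M,\rho_M)$ a left $B$-comodule and $\rho_M\circ\varphi_M=(\mu_B\otimes\varphi_M)\circ(B\otimes c_{B,B}\otimes M)\circ(\delta_B\otimes\rho_M)$. A left $\mathbb{H}$-Hopf module is a 4-tuple $(M,\psi_M^1,\psi_M^2,\rho_M)$ such that (i) $(M,\psi_M^1,\psi_M^2)$ is a left $\mathbb{H}$-module; (ii) $(M,\psi_M^1,\rho_M)$ is a left $H_1$-Hopf module; (iii) $(M,\psi_M^2,\rho_M)$ is a non-unital left $H_2$-Hopf module; (iv) if $j_M:M^{coH_1}\to M$ is the equalizer morphism of $\rho_M$ and $\eta_H\otimes M$, then $\psi_M^1\circ(\sigma_H\otimes j_M)=\psi_M^2\circ(H\otimes j_M)$. Morphisms are morphisms of left $\mathbb{H}$-modules that are also morphisms of left $H$-comodules. The category is $\mathbb{H}\text{-}\mathsf{Hopf\text{-}Mod}$. **The functors.** $\mathsf{F}(X)=(H\otimes X,\mu_H^1\otimes X,\mu_H^2\otimes X,\delta_H\otimes X)$ and $\mathsf{F}(f)=H\otimes f$. $\mathsf{W}(M,\psi_M^1,\psi_M^2,\rho_M)=M^{co\mathbb{H}}:=M^{coH_1}$,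 the equalizer object of $\rho_M$ and $\eta_H\otimes M$, and for $f:M\to N$, $\mathsf{W}(f)$ is the unique morphism $f^{coH_1}:M^{coH_1}\to N^{coH_1}$ with $j_N\circ f^{coH_1}=f\circ j_M$. *)

(* Defs.v *)
From Corelib Require Import ssreflect.
From Stdlib Require Import ProofIrrelevance.

Set Implicit Arguments.
Unset Strict Implicit.
Unset Printing Implicit Defensive.

Declare Scope cat_scope.
Local Open Scope cat_scope.

(** * Categories, functors, adjunctions *)

Record category := Category {
  Ob :> Type;
  Hom : Ob -> Ob -> Type;
  idm : forall A, Hom A A;
  comp : forall A B C, Hom B C -> Hom A B -> Hom A C;
  comp_idl : forall A B (f : Hom A B), comp (idm B) f = f;
  comp_idr : forall A B (f : Hom A B), comp f (idm A) = f;
  comp_assoc : forall A B C D (h : Hom C D) (g : Hom B C) (f : Hom A B),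
    comp h (comp g f) = comp (comp h g) f }.

Arguments Hom {c} A B.
Arguments idm {c} A.
Arguments comp {c A B C} g f.

Notation "g ∘ f" := (comp g f) (at level 40, left associativity) : cat_scope.

Definition is_iso (C : category) (A B : C) (f : Hom A B) : Prop :=
  exists g : Hom B A, g ∘ f = idm A /\ f ∘ g = idm B.

Record functor (C D : category) := Functor {
  fun_ob :> C -> D;
  fun_map : forall A B : C, Hom A B -> Hom (fun_ob A) (fun_ob B);
  fun_id : forall A, fun_map (idm A) = idm (fun_ob A);
  fun_comp : forall A B E (g : Hom B E) (f : Hom A B),
    fun_map (g ∘ f) = fun_map g ∘ fun_map f }.

(** [adjunction F G]: unit-counit data exhibiting [F] as left adjoint to [G]. *)
Record adjunction (C D : category) (F : functor C D) (G : functor D C) :=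
  Adjunction {
  adj_unit : forall X : C, Hom X (G (F X));
  adj_counit : forall Y : D, Hom (F (G Y)) Y;
  adj_unit_natural : forall X X' (f : Hom X X'),
    fun_map G (fun_map F f) ∘ adj_unit X = adj_unit X' ∘ f;
  adj_counit_natural : forall Y Y' (g : Hom Y Y'),
    g ∘ adj_counit Y = adj_counit Y' ∘ fun_map F (fun_map G g);
  adj_triangle_l : forall X,
    adj_counit (F X) ∘ fun_map F (adj_unit X) = idm (F X);
  adj_triangle_r : forall Y,
    fun_map G (adj_counit Y) ∘ adj_unit (G Y) = idm (G Y) }.

Definition is_adjoint_equivalence (C D : category) (F : functor C D)
    (G : functor D C) (adj : adjunction F G) : Prop :=
  (forall X, is_iso (adj_unit adj X)) /\ (forall Y, is_iso (adj_counit adj Y)).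

Record equalizer (C : category) (A B : C) (f g : Hom A B) := Equalizer {
  equ_ob : C;
  equ_mor : Hom equ_ob A;
  equ_eq : f ∘ equ_mor = g ∘ equ_mor;
  equ_lift : forall (X : C) (h : Hom X A), f ∘ h = g ∘ h -> Hom X equ_ob;
  equ_liftK : forall (X : C) (h : Hom X A) (e : f ∘ h = g ∘ h),
    equ_mor ∘ equ_lift e = h;
  equ_mono : forall (X : C) (u v : Hom X equ_ob),
    equ_mor ∘ u = equ_mor ∘ v -> u = v }.

(** A choice of an equalizer for every parallel pair. *)
Definition has_equalizers (C : category) : Type :=
  forall (A B : C) (f g : Hom A B), equalizer f g.

(** * Strict braided monoidal categories *)

(** The identity of [A], seen as a morphism [A -> B] when [A = B]. *)
Definition eqhom (C : category) (A B : C) (e : A = B) : Hom A B :=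
  match e in _ = B' return Hom A B' with eq_refl => idm A end.

(** Strictness: associativity and unitality of the tensor product are equalities
    of objects.  As these equalities are not definitional, the corresponding
    equalities between morphisms are mediated by [eqhom].  Pentagon and triangle
    need not be required: all their sides are of the form [eqhom e], which does
    not depend on [e] (see [eqhom_irr]). *)
Record strict_monoidal := StrictMonoidal {
  smcat :> category;
  tens : smcat -> smcat -> smcat;
  unitob : smcat;
  tensm : forall A A' B B' : smcat,
    Hom A A' -> Hom B B' -> Hom (tens A B) (tens A' B');
  tensm_id : forall A B, tensm (idm A) (idm B) = idm (tens A B);
  tensm_comp : forall A A' A'' B B' B''
      (f' : Hom A' A'') (f : Hom A A') (g' : Hom B' B'') (g : Hom B B'),
    tensm (f' ∘ f) (g' ∘ g) = tensm f' g' ∘ tensm f g;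
  tensA : forall A B C, tens (tens A B) C = tens A (tens B C);
  tens1l : forall A, tens unitob A = A;
  tens1r : forall A, tens A unitob = A;
  tensmA : forall A A' B B' C C' (f : Hom A A') (g : Hom B B') (h : Hom C C'),
    eqhom (tensA A' B' C') ∘ tensm (tensm f g) h
    = tensm f (tensm g h) ∘ eqhom (tensA A B C);
  tensm1l : forall A A' (f : Hom A A'),
    eqhom (tens1l A') ∘ tensm (idm unitob) f = f ∘ eqhom (tens1l A);
  tensm1r : forall A A' (f : Hom A A'),
    eqhom (tens1r A') ∘ tensm f (idm unitob) = f ∘ eqhom (tens1r A) }.

Arguments tens {s} A B.
Arguments unitob {s}.
Arguments tensm {s A A' B B'} f g.

Notation "A ⊗ B" := (tens A B) (at level 35, right associativity) : cat_scope.
Notation "f ⊠ g" := (tensm f g) (at level 35, right associativity) : cat_scope.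
Notation "P ◁ f" := (tensm (idm P) f)
  (at level 35, right associativity) : cat_scope.
Notation "f ▷ P" := (tensm f (idm P))
  (at level 35, right associativity) : cat_scope.
Notation "'𝟙'" := unitob : cat_scope.

Section StructuralIdentities.
Variable C : strict_monoidal.
Implicit Types A B D : C.

Definition asso A B D : Hom ((A ⊗ B) ⊗ D) (A ⊗ B ⊗ D) := eqhom (tensA A B D).
Definition asso' A B D : Hom (A ⊗ B ⊗ D) ((A ⊗ B) ⊗ D) :=
  eqhom (eq_sym (tensA A B D)).
Definition luni A : Hom (𝟙 ⊗ A) A := eqhom (tens1l A).
Definition luni' A : Hom A (𝟙 ⊗ A) := eqhom (eq_sym (tens1l A)).
Definition runi A : Hom (A ⊗ 𝟙) A := eqhom (tens1r A).
Definition runi' A : Hom A (A ⊗ 𝟙) := eqhom (eq_sym (tens1r A)).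
End StructuralIdentities.

Record strict_braided_monoidal := StrictBraidedMonoidal {
  sbmcat :> strict_monoidal;
  braid : forall A B : sbmcat, Hom (A ⊗ B) (B ⊗ A);
  braid_iso : forall A B, is_iso (braid A B);
  braid_natural : forall A A' B B' (f : Hom A A') (g : Hom B B'),
    braid A' B' ∘ (f ⊠ g) = (g ⊠ f) ∘ braid A B;
  braid_hexl : forall A B D,
    braid A (B ⊗ D)
    = asso' B D A ∘ (B ◁ braid A D) ∘ asso B A D ∘ (braid A B ▷ D)
      ∘ asso' A B D;
  braid_hexr : forall A B D,
    braid (A ⊗ B) D
    = asso D A B ∘ (braid A D ▷ B) ∘ asso' A D B ∘ (A ◁ braid B D)
      ∘ asso A B D }.

Arguments braid {s} A B.

(** * Hopf monoids, Hopf trusses and their Hopf modules *)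

Section HopfDefinitions.
Variable C : strict_braided_monoidal.
Implicit Types A D E H M X : C.

(** [A ⊗ c_{B,D} ⊗ E]. *)
Definition braid_mid A B D E : Hom ((A ⊗ B) ⊗ (D ⊗ E)) ((A ⊗ D) ⊗ (B ⊗ E)) :=
  asso' A D (B ⊗ E)
  ∘ (A ◁ (asso D B E ∘ (braid B D ▷ E) ∘ asso' B D E))
  ∘ asso A B (D ⊗ E).

Definition is_associative A (mu : Hom (A ⊗ A) A) : Prop :=
  mu ∘ (A ◁ mu) ∘ asso A A A = mu ∘ (mu ▷ A).

Record is_monoid A (eta : Hom 𝟙 A) (mu : Hom (A ⊗ A) A) : Prop := IsMonoid {
  monoid_assoc : is_associative mu;
  monoid_unitl : mu ∘ (eta ▷ A) ∘ luni' A = idm A;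
  monoid_unitr : mu ∘ (A ◁ eta) ∘ runi' A = idm A }.

Record is_comonoid D (eps : Hom D 𝟙) (delta : Hom D (D ⊗ D)) : Prop :=
  IsComonoid {
  comonoid_coassoc : asso D D D ∘ (delta ▷ D) ∘ delta = (D ◁ delta) ∘ delta;
  comonoid_counitl : luni D ∘ (eps ▷ D) ∘ delta = idm D;
  comonoid_counitr : runi D ∘ (D ◁ eps) ∘ delta = idm D }.

Record is_comonoid_mor D (epsD : Hom D 𝟙) (deltaD : Hom D (D ⊗ D))
    E (epsE : Hom E 𝟙) (deltaE : Hom E (E ⊗ E)) (f : Hom D E) : Prop :=
  IsComonoidMor {
  comonoid_mor_counit : epsE ∘ f = epsD;
  comonoid_mor_comult : deltaE ∘ f = (f ⊠ f) ∘ deltaD }.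

(** The comonoid structures on the unit object and on [D ⊗ E]. *)
Definition unit_counit : Hom (𝟙 : C) 𝟙 := idm 𝟙.
Definition unit_comult : Hom (𝟙 : C) (𝟙 ⊗ 𝟙) := luni' 𝟙.
Definition tens_counit D E (epsD : Hom D 𝟙) (epsE : Hom E 𝟙) : Hom (D ⊗ E) 𝟙 :=
  luni 𝟙 ∘ (epsD ⊠ epsE).
Definition tens_comult D E (deltaD : Hom D (D ⊗ D)) (deltaE : Hom E (E ⊗ E)) :
    Hom (D ⊗ E) ((D ⊗ E) ⊗ (D ⊗ E)) :=
  braid_mid D D E E ∘ (deltaD ⊠ deltaE).

Record is_nonunital_bimonoid H (mu : Hom (H ⊗ H) H)
    (eps : Hom H 𝟙) (delta : Hom H (H ⊗ H)) : Prop := IsNonunitalBimonoid {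
  nubimonoid_assoc : is_associative mu;
  nubimonoid_comonoid : is_comonoid eps delta;
  nubimonoid_mul_comor :
    is_comonoid_mor (tens_counit eps eps) (tens_comult delta delta)
      eps delta mu }.

Record is_bimonoid H (eta : Hom 𝟙 H) (mu : Hom (H ⊗ H) H)
    (eps : Hom H 𝟙) (delta : Hom H (H ⊗ H)) : Prop := IsBimonoid {
  bimonoid_monoid : is_monoid eta mu;
  bimonoid_comonoid : is_comonoid eps delta;
  bimonoid_unit_comor : is_comonoid_mor unit_counit unit_comult eps delta eta;
  bimonoid_mul_comor :
    is_comonoid_mor (tens_counit eps eps) (tens_comult delta delta)
      eps delta mu }.

Record is_hopf_monoid H (eta : Hom 𝟙 H) (mu : Hom (H ⊗ H) H)
    (eps : Hom H 𝟙) (delta : Hom H (H ⊗ H)) (lambda : Hom H H) : Prop :=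
  IsHopfMonoid {
  hopf_bimonoid : is_bimonoid eta mu eps delta;
  hopf_antipoder : mu ∘ (H ◁ lambda) ∘ delta = eta ∘ eps;
  hopf_antipodel : mu ∘ (lambda ▷ H) ∘ delta = eta ∘ eps }.

(** [Γ_M^σ = ψ¹ ∘ ((λ ∘ σ) ⊗ ψ²) ∘ (δ ⊗ M)]. *)
Definition Gamma H (delta : Hom H (H ⊗ H)) (lambda sigma : Hom H H)
    M (psi1 psi2 : Hom (H ⊗ M) M) : Hom (H ⊗ M) M :=
  psi1 ∘ ((lambda ∘ sigma) ⊠ psi2) ∘ asso H H M ∘ (delta ▷ M).

(** The distributivity law relating [psi1] and [psi2]; for [M = H],
    [psi1 = mu1] and [psi2 = mu2] it is the one in the definition of a
    Hopf truss. *)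
Definition truss_law H (mu2 : Hom (H ⊗ H) H) (delta : Hom H (H ⊗ H))
    (lambda sigma : Hom H H) M (psi1 psi2 : Hom (H ⊗ M) M) : Prop :=
  psi2 ∘ (H ◁ psi1)
  = psi1 ∘ (mu2 ⊠ Gamma delta lambda sigma psi1 psi2)
    ∘ braid_mid H H H M ∘ (delta ▷ (H ⊗ M)).

Definition is_nonunital_module H (mu : Hom (H ⊗ H) H)
    M (phi : Hom (H ⊗ M) M) : Prop :=
  phi ∘ (H ◁ phi) ∘ asso H H M = phi ∘ (mu ▷ M).

Record is_module H (eta : Hom 𝟙 H) (mu : Hom (H ⊗ H) H)
    M (phi : Hom (H ⊗ M) M) : Prop := IsModule {
  module_assoc : is_nonunital_module mu phi;
  module_unit : phi ∘ (eta ▷ M) ∘ luni' M = idm M }.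

Record is_comodule H (eps : Hom H 𝟙) (delta : Hom H (H ⊗ H))
    M (rho : Hom M (H ⊗ M)) : Prop := IsComodule {
  comodule_coassoc : asso H H M ∘ (delta ▷ M) ∘ rho = (H ◁ rho) ∘ rho;
  comodule_counit : luni M ∘ (eps ▷ M) ∘ rho = idm M }.

Definition hopf_compat H (mu : Hom (H ⊗ H) H) (delta : Hom H (H ⊗ H))
    M (phi : Hom (H ⊗ M) M) (rho : Hom M (H ⊗ M)) : Prop :=
  rho ∘ phi = (mu ⊠ phi) ∘ braid_mid H H H M ∘ (delta ⊠ rho).

Record is_hopf_module H (eta : Hom 𝟙 H) (mu : Hom (H ⊗ H) H)
    (eps : Hom H 𝟙) (delta : Hom H (H ⊗ H))
    M (phi : Hom (H ⊗ M) M) (rho : Hom M (H ⊗ M)) : Prop := IsHopfModule {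
  hopf_module_module : is_module eta mu phi;
  hopf_module_comodule : is_comodule eps delta rho;
  hopf_module_compat : hopf_compat mu delta phi rho }.

Record is_nonunital_hopf_module H (mu : Hom (H ⊗ H) H)
    (eps : Hom H 𝟙) (delta : Hom H (H ⊗ H))
    M (phi : Hom (H ⊗ M) M) (rho : Hom M (H ⊗ M)) : Prop :=
  IsNonunitalHopfModule {
  nuhopf_module_module : is_nonunital_module mu phi;
  nuhopf_module_comodule : is_comodule eps delta rho;
  nuhopf_module_compat : hopf_compat mu delta phi rho }.

End HopfDefinitions.

Record hopf_truss (C : strict_braided_monoidal) := HopfTruss {
  truss_ob :> C;
  t_eps : Hom truss_ob 𝟙;
  t_delta : Hom truss_ob (truss_ob ⊗ truss_ob);
  t_eta : Hom 𝟙 truss_ob;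
  t_mu1 : Hom (truss_ob ⊗ truss_ob) truss_ob;
  t_mu2 : Hom (truss_ob ⊗ truss_ob) truss_ob;
  t_lambda : Hom truss_ob truss_ob;
  t_sigma : Hom truss_ob truss_ob;
  truss_H1 : is_hopf_monoid t_eta t_mu1 t_eps t_delta t_lambda;
  truss_H2 : is_nonunital_bimonoid t_mu2 t_eps t_delta;
  truss_sigma_comor : is_comonoid_mor t_eps t_delta t_eps t_delta t_sigma;
  truss_compat : truss_law t_mu2 t_delta t_lambda t_sigma t_mu1 t_mu2 }.

Arguments t_eps {C} h.
Arguments t_delta {C} h.
Arguments t_eta {C} h.
Arguments t_mu1 {C} h.
Arguments t_mu2 {C} h.
Arguments t_lambda {C} h.
Arguments t_sigma {C} h.

Record is_truss_module (C : strict_braided_monoidal) (H : hopf_truss C)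
    (M : C) (psi1 psi2 : Hom (H ⊗ M) M) : Prop := IsTrussModule {
  truss_module_act1 : is_module (t_eta H) (t_mu1 H) psi1;
  truss_module_act2 : is_nonunital_module (t_mu2 H) psi2;
  truss_module_law :
    truss_law (t_mu2 H) (t_delta H) (t_lambda H) (t_sigma H) psi1 psi2 }.

(** The coinvariants [M^{coH}] with their inclusion [j_M] into [M]. *)
Definition coinv (C : strict_braided_monoidal) (E : has_equalizers C)
    (H : hopf_truss C) (M : C) (rho : Hom M (H ⊗ M)) :
    equalizer rho ((t_eta H ▷ M) ∘ luni' M) :=
  E _ _ rho ((t_eta H ▷ M) ∘ luni' M).

Record truss_hopf_module (C : strict_braided_monoidal) (E : has_equalizers C)
    (H : hopf_truss C) := TrussHopfModule {
  hm_ob :> C;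
  hm_act1 : Hom (H ⊗ hm_ob) hm_ob;
  hm_act2 : Hom (H ⊗ hm_ob) hm_ob;
  hm_coact : Hom hm_ob (H ⊗ hm_ob);
  hm_module : is_truss_module hm_act1 hm_act2;
  hm_hopf1 : is_hopf_module (t_eta H) (t_mu1 H) (t_eps H) (t_delta H)
    hm_act1 hm_coact;
  hm_hopf2 : is_nonunital_hopf_module (t_mu2 H) (t_eps H) (t_delta H)
    hm_act2 hm_coact;
  hm_coinv : hm_act1 ∘ (t_sigma H ⊠ equ_mor (coinv E hm_coact))
           = hm_act2 ∘ (H ◁ equ_mor (coinv E hm_coact)) }.

Record truss_hopf_hom (C : strict_braided_monoidal) (E : has_equalizers C)
    (H : hopf_truss C) (M N : truss_hopf_module E H) := TrussHopfHom {
  hm_map :> Hom (hm_ob M) (hm_ob N);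
  hm_map_act1 : hm_map ∘ hm_act1 M = hm_act1 N ∘ (H ◁ hm_map);
  hm_map_act2 : hm_map ∘ hm_act2 M = hm_act2 N ∘ (H ◁ hm_map);
  hm_map_coact : hm_coact N ∘ hm_map = (H ◁ hm_map) ∘ hm_coact M }.

(** * Calculus with [eqhom] *)

Section Eqhom.
Variable C : category.
Implicit Types A B D : C.

Lemma eqhom_irr A B (e e' : A = B) : eqhom e = eqhom e'.
Proof. by rewrite (proof_irrelevance _ e e'). Qed.

Lemma eqhom_id A (e : A = A) : eqhom e = idm A.
Proof. exact: (eqhom_irr e eq_refl). Qed.

Lemma eqhom_comp A B D (e : A = B) (e' : B = D) :
  eqhom e' ∘ eqhom e = eqhom (eq_trans e e').
Proof. by destruct e', e; rewrite comp_idl. Qed.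

Lemma eqhomK A B (e : A = B) (e' : B = A) : eqhom e' ∘ eqhom e = idm A.
Proof. by rewrite eqhom_comp eqhom_id. Qed.

(** Equality of morphisms up to equality of sources and targets. *)
Definition heq A B (f : Hom A B) A' B' (g : Hom A' B') : Prop :=
  exists (eA : A = A') (eB : B = B'), eqhom eB ∘ f = g ∘ eqhom eA.

Lemma heq_eq A B (f g : Hom A B) : heq f g -> f = g.
Proof. by move=> [eA [eB]]; rewrite !eqhom_id comp_idl comp_idr. Qed.

Lemma heq_refl A B (f : Hom A B) : heq f f.
Proof. by exists eq_refl, eq_refl; rewrite comp_idl comp_idr. Qed.

Lemma eq_heq A B (f g : Hom A B) : f = g -> heq f g.
Proof. by move=> ->; apply: heq_refl. Qed.

Lemma heq_sym A B (f : Hom A B) A' B' (g : Hom A' B') : heq f g -> heq g f.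
Proof.
move=> [eA [eB]]; destruct eA, eB; rewrite /= comp_idl comp_idr => ->.
exact: heq_refl.
Qed.

Lemma heq_trans A B (f : Hom A B) A' B' (g : Hom A' B')
  A'' B'' (h : Hom A'' B'') : heq f g -> heq g h -> heq f h.
Proof.
move=> [eA [eB]]; destruct eA, eB; rewrite /= comp_idl comp_idr => ->; exact.
Qed.

Lemma heq_comp A B D (g : Hom B D) (f : Hom A B)
    A' B' D' (g' : Hom B' D') (f' : Hom A' B') :
  heq g g' -> heq f f' -> heq (g ∘ f) (g' ∘ f').
Proof.
move=> [eB [eD eg]] [eA [eB' ef]]; exists eA, eD.
by rewrite comp_assoc eg -comp_assoc (eqhom_irr eB eB') ef comp_assoc.
Qed.

Lemma heq_castl A B D (e : B = D) (f : Hom A B) A' B' (g : Hom A' B') :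
  heq f g -> heq (eqhom e ∘ f) g.
Proof. by destruct e; rewrite comp_idl. Qed.

Lemma heq_castr A B D (e : D = A) (f : Hom A B) A' B' (g : Hom A' B') :
  heq f g -> heq (f ∘ eqhom e) g.
Proof. by destruct e; rewrite comp_idr. Qed.

End Eqhom.

Section EqhomTensor.
Variable C : strict_monoidal.
Implicit Types A B D X : C.

Lemma eqhom_tens A B A' B' (e : A = A') (e' : B = B') :
  exists e'' : A ⊗ B = A' ⊗ B', eqhom e ⊠ eqhom e' = eqhom e''.
Proof. by destruct e, e'; exists eq_refl; rewrite /= tensm_id. Qed.

Lemma heq_tens A B (f : Hom A B) A' B' (f' : Hom A' B')
    D E (g : Hom D E) D' E' (g' : Hom D' E') :
  heq f f' -> heq g g' -> heq (f ⊠ g) (f' ⊠ g').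
Proof.
move=> [eA [eB ef]] [eD [eE eg]].
have [e1 h1] := eqhom_tens eA eD; have [e2 h2] := eqhom_tens eB eE.
by exists e1, e2; rewrite -h1 -h2 -!tensm_comp ef eg.
Qed.

Lemma heq_tensA A A' B B' D D' (f : Hom A A') (g : Hom B B') (h : Hom D D') :
  heq ((f ⊠ g) ⊠ h) (f ⊠ g ⊠ h).
Proof. by exists (tensA A B D), (tensA A' B' D'); apply: tensmA. Qed.

Lemma heq_tens1l A B (f : Hom A B) : heq (idm 𝟙 ⊠ f) f.
Proof. by exists (tens1l A), (tens1l B); apply: tensm1l. Qed.

Lemma heq_tens1r A B (f : Hom A B) : heq (f ⊠ idm 𝟙) f.
Proof. by exists (tens1r A), (tens1r B); apply: tensm1r. Qed.

(** [g] is [f ⊗ X], up to reassociation. *)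
Definition lifts X A B (f : Hom A B) A' B' (g : Hom A' B') : Prop :=
  heq g (f ▷ X).

Lemma lifts_base X A B (f : Hom A B) : lifts X f (f ▷ X).
Proof. exact: heq_refl. Qed.

Lemma lifts_id X A : lifts X (idm A) (idm (A ⊗ X)).
Proof. by apply: eq_heq; rewrite tensm_id. Qed.

Lemma lifts_idA X A B : lifts X (idm (A ⊗ B)) (idm (A ⊗ B ⊗ X)).
Proof.
rewrite -[idm (A ⊗ B ⊗ X)]tensm_id -(tensm_id A B) -(tensm_id B X).
exact/heq_sym/heq_tensA.
Qed.

Lemma lifts_comp X A B D (g : Hom B D) (f : Hom A B)
    A' B' D' (g' : Hom B' D') (f' : Hom A' B') :
  lifts X g g' -> lifts X f f' -> lifts X (g ∘ f) (g' ∘ f').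
Proof.
move=> hg hf; rewrite /lifts -{1}(comp_idl (idm X)) tensm_comp.
exact: heq_comp.
Qed.

Lemma lifts_tens X D D' (k : Hom D D') A B (f : Hom A B)
    A' B' (f' : Hom A' B') :
  lifts X f f' -> lifts X (k ⊠ f) (k ⊠ f').
Proof.
move=> hf; apply: heq_trans (heq_sym (heq_tensA k f (idm X))).
by apply: heq_tens => //; apply: heq_refl.
Qed.

Lemma lifts_castl X A B (f : Hom A B) A' B' D' (e : B' = D') (f' : Hom A' B') :
  lifts X f f' -> lifts X f (eqhom e ∘ f').
Proof. exact: heq_castl. Qed.

Lemma lifts_castr X A B (f : Hom A B) A' B' D' (e : D' = A') (f' : Hom A' B') :
  lifts X f f' -> lifts X f (f' ∘ eqhom e).
Proof. exact: heq_castr. Qed.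

Lemma lifts_castl' X A B D (e : B = D) (f : Hom A B) A' B' (f' : Hom A' B') :
  lifts X f f' -> lifts X (eqhom e ∘ f) f'.
Proof. by destruct e; rewrite comp_idl. Qed.

Lemma lifts_castr' X A B D (e : D = A) (f : Hom A B) A' B' (f' : Hom A' B') :
  lifts X f f' -> lifts X (f ∘ eqhom e) f'.
Proof. by destruct e; rewrite comp_idr. Qed.

Lemma lifts_eq X A B (f g : Hom A B) A' B' (f' g' : Hom A' B') :
  f = g -> lifts X f f' -> lifts X g g' -> f' = g'.
Proof.
by move=> -> hf hg; apply/heq_eq/(heq_trans hf)/heq_sym.
Qed.

Lemma whisk_comp A B D X (g : Hom B D) (f : Hom A B) :
  X ◁ (g ∘ f) = (X ◁ g) ∘ (X ◁ f).
Proof. by rewrite -tensm_comp comp_idl. Qed.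

Lemma whisk_exchange A B D E (f : Hom A B) (g : Hom D E) :
  (f ▷ E) ∘ (A ◁ g) = (B ◁ g) ∘ (f ▷ D).
Proof. by rewrite -!tensm_comp !comp_idl !comp_idr. Qed.

Lemma luni'_natural A B (f : Hom A B) : luni' B ∘ f = (𝟙 ◁ f) ∘ luni' A.
Proof.
apply: heq_eq; apply/heq_castl/heq_sym/heq_castr; exact: heq_tens1l.
Qed.

Lemma runi'_natural A B (f : Hom A B) : runi' B ∘ f = (f ▷ 𝟙) ∘ runi' A.
Proof.
apply: heq_eq; apply/heq_castl/heq_sym/heq_castr; exact: heq_tens1r.
Qed.

Lemma luniK A : luni' A ∘ luni A = idm (𝟙 ⊗ A).
Proof. exact: eqhomK. Qed.

Lemma luni'K A : luni A ∘ luni' A = idm A.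
Proof. exact: eqhomK. Qed.

Lemma runiK A : runi' A ∘ runi A = idm (A ⊗ 𝟙).
Proof. exact: eqhomK. Qed.

Lemma runi'K A : runi A ∘ runi' A = idm A.
Proof. exact: eqhomK. Qed.

End EqhomTensor.

Ltac lifts := rewrite /braid_mid /Gamma /asso /asso' /luni /luni' /runi /runi';
  repeat first
  [ exact: lifts_base | exact: lifts_id | exact: lifts_idA
  | apply: lifts_castl | apply: lifts_castr
  | apply: lifts_castl' | apply: lifts_castr'
  | apply: lifts_comp | apply: lifts_tens ].

Section FreeModule.
Variables (C : strict_braided_monoidal) (H X : C).
Variables (eta : Hom 𝟙 H) (mu mu1 mu2 : Hom (H ⊗ H) H).
Variables (eps : Hom H 𝟙) (delta : Hom H (H ⊗ H)) (lambda sigma : Hom H H).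

Definition free_act (m : Hom (H ⊗ H) H) : Hom (H ⊗ H ⊗ X) (H ⊗ X) :=
  (m ▷ X) ∘ asso' H H X.
Definition free_coact : Hom (H ⊗ X) (H ⊗ H ⊗ X) :=
  asso H H X ∘ (delta ▷ X).

Lemma free_nonunital_module :
  is_associative mu -> is_nonunital_module mu (free_act mu).
Proof. by move=> h; apply: (lifts_eq (X := X) h); rewrite /free_act; lifts. Qed.

Lemma free_module : is_monoid eta mu -> is_module eta mu (free_act mu).
Proof.
move=> [ha h _]; split; first exact: free_nonunital_module.
by apply: (lifts_eq (X := X) h); rewrite /free_act; lifts.
Qed.

Lemma free_comodule :
  is_comonoid eps delta -> is_comodule eps delta free_coact.
Proof.
by move=> [h1 h2 _]; split; [apply: (lifts_eq (X := X) h1)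
  | apply: (lifts_eq (X := X) h2)]; rewrite /free_coact; lifts.
Qed.

Lemma free_compat :
  is_comonoid_mor (tens_counit eps eps) (tens_comult delta delta)
    eps delta mu ->
  hopf_compat mu delta (free_act mu) free_coact.
Proof.
move=> [_]; rewrite /tens_comult comp_assoc => h.
by apply: (lifts_eq (X := X) h); rewrite /free_act /free_coact; lifts.
Qed.

Lemma free_truss_law : truss_law mu2 delta lambda sigma mu1 mu2 ->
  truss_law mu2 delta lambda sigma (free_act mu1) (free_act mu2).
Proof.
by move=> h; apply: (lifts_eq (X := X) h); rewrite /free_act; lifts.
Qed.

End FreeModule.

Section BraidMid.
Variable C : strict_braided_monoidal.
Implicit Types A B D E : C.

Lemma heq_braid A B A' B' : A = A' -> B = B' -> heq (braid A B) (braid A' B').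
Proof. by move=> -> ->; apply: heq_refl. Qed.

Lemma braid_unit A : braid A 𝟙 = luni' A ∘ runi A.
Proof.
pose c := luni A ∘ braid A 𝟙 ∘ runi' A.
have hc : heq c (braid A 𝟙) by apply/heq_castr/heq_castl/heq_refl.
have cc : c ∘ c = c.
  apply: heq_eq; apply: heq_trans (heq_sym hc).
  apply: heq_trans (heq_braid (eq_refl A) (tens1l 𝟙)).
  rewrite braid_hexl; apply/heq_sym/heq_castr; apply: heq_comp.
    apply/heq_castr/heq_castl; apply: heq_trans (heq_tens1l _) _.
    exact: heq_sym.
  by apply: heq_trans (heq_tens1r _) _; apply: heq_sym.
have [d [dl _]] := braid_iso A 𝟙.
have c1 : c = idm A.
  have e : (runi A ∘ d ∘ luni' A) ∘ c = idm A.
    rewrite /c !comp_assoc -(comp_assoc _ (luni' A)) luniK comp_idr.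
    by rewrite -(comp_assoc _ d) dl comp_idr runi'K.
  by rewrite -{1}(comp_idl c) -e -comp_assoc cc.
have -> : braid A 𝟙 = luni' A ∘ c ∘ runi A.
  rewrite /c !comp_assoc luniK comp_idl -comp_assoc runiK.
  by rewrite comp_idr.
by rewrite c1 comp_idr.
Qed.

Lemma asso'_natural A A' B B' D D' (f : Hom A A') (g : Hom B B')
    (h : Hom D D') :
  asso' A' B' D' ∘ (f ⊠ g ⊠ h) = ((f ⊠ g) ⊠ h) ∘ asso' A B D.
Proof.
by apply: heq_eq; apply/heq_castl/heq_sym/heq_castr/heq_tensA.
Qed.

Lemma asso_natural A A' B B' D D' (f : Hom A A') (g : Hom B B')
    (h : Hom D D') :
  asso A' B' D' ∘ ((f ⊠ g) ⊠ h) = (f ⊠ g ⊠ h) ∘ asso A B D.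
Proof. exact: tensmA. Qed.

Lemma braid_mid_natural A A' B B' D D' E E' (a : Hom A A') (b : Hom B B')
    (d : Hom D D') (e : Hom E E') :
  braid_mid A' B' D' E' ∘ ((a ⊠ b) ⊠ (d ⊠ e))
  = ((a ⊠ d) ⊠ (b ⊠ e)) ∘ braid_mid A B D E.
Proof.
rewrite /braid_mid -comp_assoc asso_natural comp_assoc.
rewrite -(comp_assoc (asso' _ _ _)) -tensm_comp comp_idl.
have -> : asso D' B' E' ∘ (braid B' D' ▷ E') ∘ asso' B' D' E' ∘ (b ⊠ d ⊠ e)
    = (d ⊠ b ⊠ e) ∘ (asso D B E ∘ (braid B D ▷ E) ∘ asso' B D E).
  rewrite -comp_assoc asso'_natural comp_assoc -(comp_assoc (asso _ _ _)).
  rewrite -tensm_comp braid_natural comp_idl !comp_assoc -asso_natural.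
  by rewrite -(comp_assoc (asso _ _ _) (_ ⊠ _) (_ ⊠ _)) -tensm_comp comp_idr.
rewrite -{1}(comp_idr a) tensm_comp comp_assoc asso'_natural.
by rewrite !comp_assoc.
Qed.

Lemma braid_mid_unit A B E : exists e,
  braid_mid A B 𝟙 E = eqhom e.
Proof.
rewrite /braid_mid braid_unit /luni' /runi eqhom_comp.
have [e1 ->] := eqhom_tens (eq_trans (tens1r B) (eq_sym (tens1l B)))
  (eq_refl E).
rewrite /asso /asso' !eqhom_comp.
set e2 := eq_trans _ (eq_trans _ _).
have [e3 ->] := eqhom_tens (eq_refl A) e2.
rewrite !eqhom_comp; by eexists.
Qed.

End BraidMid.

Section TrussFacts.
Variables (C : strict_braided_monoidal) (H : hopf_truss C).

Notation eps := (t_eps H).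
Notation delta := (t_delta H).
Notation eta := (t_eta H).
Notation mu1 := (t_mu1 H).
Notation mu2 := (t_mu2 H).
Notation lambda := (t_lambda H).
Notation sigma := (t_sigma H).

Let bim := hopf_bimonoid (truss_H1 H).
Let mon := bimonoid_monoid bim.
Let com := bimonoid_comonoid bim.

Definition conv (f g : Hom H H) : Hom H H := mu1 ∘ (f ⊠ g) ∘ delta.

Lemma convA f g h : conv f (conv g h) = conv (conv f g) h.
Proof.
rewrite /conv.
have -> : f ⊠ (mu1 ∘ (g ⊠ h) ∘ delta)
    = (H ◁ mu1) ∘ (f ⊠ g ⊠ h) ∘ (H ◁ delta).
  by rewrite -!tensm_comp comp_idl comp_idr.
have -> : (mu1 ∘ (f ⊠ g) ∘ delta) ⊠ h
    = (mu1 ▷ H) ∘ ((f ⊠ g) ⊠ h) ∘ (delta ▷ H).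
  by rewrite -!tensm_comp comp_idl comp_idr.
rewrite !comp_assoc -(monoid_assoc mon) -[LHS]comp_assoc.
rewrite -(comonoid_coassoc com) !comp_assoc.
by rewrite -(comp_assoc _ (asso _ _ _) (_ ⊠ h)) asso_natural !comp_assoc.
Qed.

Lemma conv1l f : conv (eta ∘ eps) f = f.
Proof.
rewrite /conv.
have -> : (eta ∘ eps) ⊠ f = (eta ▷ H) ∘ (𝟙 ◁ f) ∘ (eps ▷ H).
  by rewrite -!tensm_comp !comp_idr comp_idl.
have e : (eps ▷ H) ∘ delta = luni' H.
  rewrite -[LHS]comp_idl -luniK -comp_assoc (comp_assoc (luni _)).
  by rewrite (comonoid_counitl com) comp_idr.
rewrite -comp_assoc -(comp_assoc _ _ delta) e -(comp_assoc (eta ▷ _)).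
by rewrite -luni'_natural !comp_assoc (monoid_unitl mon) comp_idl.
Qed.

Lemma conv1r f : conv f (eta ∘ eps) = f.
Proof.
rewrite /conv.
have -> : f ⊠ (eta ∘ eps) = (H ◁ eta) ∘ (f ▷ 𝟙) ∘ (H ◁ eps).
  by rewrite -!tensm_comp !comp_idr comp_idl.
have e : (H ◁ eps) ∘ delta = runi' H.
  rewrite -[LHS]comp_idl -runiK -comp_assoc (comp_assoc (runi _)).
  by rewrite (comonoid_counitr com) comp_idr.
rewrite -comp_assoc -(comp_assoc _ _ delta) e -(comp_assoc (_ ◁ eta)).
by rewrite -runi'_natural !comp_assoc (monoid_unitr mon) comp_idl.
Qed.

Lemma conv_antipodel f : is_comonoid_mor eps delta eps delta f ->
  conv (lambda ∘ f) f = eta ∘ eps.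
Proof.
move=> [h1 h2]; rewrite /conv.
rewrite -{2}(comp_idl f) tensm_comp -!comp_assoc -h2 !comp_assoc.
by rewrite (hopf_antipodel (truss_H1 H)) -comp_assoc h1.
Qed.

Lemma conv_antipoder f : is_comonoid_mor eps delta eps delta f ->
  conv f (lambda ∘ f) = eta ∘ eps.
Proof.
move=> [h1 h2]; rewrite /conv.
rewrite -{1}(comp_idl f) tensm_comp -!comp_assoc -h2 !comp_assoc.
by rewrite (hopf_antipoder (truss_H1 H)) -comp_assoc h1.
Qed.

(** Right multiplication by the unit in [H2]; it turns out to be [sigma]. *)
Let tau : Hom H H := mu2 ∘ (H ◁ eta) ∘ runi' H.

Lemma diag_unit :
  braid_mid H H 𝟙 𝟙 ∘ (delta ⊠ luni' 𝟙) ∘ runi' H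
  = (runi' H ⊠ runi' H) ∘ delta.
Proof.
have [e1 ->] := braid_mid_unit H H (𝟙 : C).
rewrite /runi'; have [e2 ->] := eqhom_tens (eq_sym (tens1r H))
  (eq_sym (tens1r H)).
apply: heq_eq; apply/heq_castr/heq_castl/heq_sym/heq_castl/heq_sym.
apply: heq_trans (heq_tens1r _); apply: heq_tens; first exact: heq_refl.
rewrite -(comp_idr (luni' _)); exact/heq_castl/heq_refl.
Qed.

Lemma delta_unit :
  (delta ⊠ (t_delta H ∘ eta)) = ((H ⊗ H) ◁ (eta ⊠ eta)) ∘ (delta ⊠ luni' 𝟙).
Proof.
rewrite (comonoid_mor_comult (bimonoid_unit_comor bim)) /unit_comult.
by rewrite -tensm_comp comp_idl.
Qed.

Lemma comult_unit :
  braid_mid H H H H ∘ (delta ⊠ (delta ∘ eta)) ∘ runi' H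
  = (((H ◁ eta) ∘ runi' H) ⊠ ((H ◁ eta) ∘ runi' H)) ∘ delta.
Proof.
rewrite delta_unit -(tensm_id H H) comp_assoc braid_mid_natural.
by rewrite -2!comp_assoc (comp_assoc (braid_mid _ _ _ _)) diag_unit comp_assoc
  -tensm_comp.
Qed.

Lemma tau_comonoid_mor : is_comonoid_mor eps delta eps delta tau.
Proof.
have [he hd] := nubimonoid_mul_comor (truss_H2 H).
have [ee _] := bimonoid_unit_comor bim.
split; rewrite /tau !comp_assoc.
  rewrite he /tens_counit -(comp_assoc (luni 𝟙)) -tensm_comp comp_idr ee.
  exact/heq_eq/heq_castr/heq_castl/heq_tens1r.
rewrite hd /tens_comult comp_assoc -(comp_assoc _ (delta ⊠ delta)).
rewrite -tensm_comp comp_idr -2!comp_assoc (comp_assoc (braid_mid _ _ _ _)).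
by rewrite comult_unit comp_assoc -tensm_comp !comp_assoc.
Qed.

Lemma Gamma_unit : Gamma delta lambda sigma mu1 mu2 ∘ ((H ◁ eta) ∘ runi' H)
  = conv (lambda ∘ sigma) tau.
Proof.
rewrite /Gamma /conv /tau comp_assoc -(comp_assoc _ (delta ▷ H)).
rewrite whisk_exchange !comp_assoc -(tensm_id H H).
rewrite -(comp_assoc _ (asso _ _ _)) asso_natural comp_assoc.
rewrite -(comp_assoc mu1) -tensm_comp comp_idr.
have -> : (lambda ∘ sigma) ⊠ (mu2 ∘ (H ◁ eta) ∘ runi' H)
   = (lambda ∘ sigma) ⊠ (mu2 ∘ (H ◁ eta)) ∘ (H ◁ runi' H).
  by rewrite -tensm_comp comp_idr.
rewrite !comp_assoc -2![LHS]comp_assoc -[RHS]comp_assoc; congr (_ ∘ _).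
rewrite comp_assoc; apply: heq_eq; apply: heq_castr; apply: heq_castl.
apply: heq_trans (heq_tens1r _) _; apply: heq_sym.
have [e ->] := eqhom_tens (eq_refl (H : C)) (eq_sym (tens1r (H : C))).
exact/heq_castl/heq_refl.
Qed.

Lemma tau_conv : tau = conv tau (conv (lambda ∘ sigma) tau).
Proof.
have ed := comonoid_mor_comult (bimonoid_unit_comor bim).
have hl : mu1 ∘ (delta ∘ eta) = eta.
  rewrite ed /unit_comult -{1}(comp_idr eta) -{2}(comp_idl eta) tensm_comp.
  rewrite -comp_assoc -luni'_natural !comp_assoc.
  by rewrite (monoid_unitl mon) comp_idl.
rewrite {1}/tau -{1}hl whisk_comp comp_assoc (truss_compat H).
rewrite -(comp_assoc _ (delta ▷ _)) -tensm_comp comp_idl comp_idr.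
rewrite -2!comp_assoc (comp_assoc (braid_mid _ _ _ _)) comult_unit.
rewrite !comp_assoc -(comp_assoc mu1) -tensm_comp Gamma_unit.
by rewrite /tau !comp_assoc.
Qed.

Lemma tau_sigma : tau = sigma.
Proof.
have ts := tau_conv.
have hs := truss_sigma_comor H.
have e : conv (lambda ∘ sigma) tau = eta ∘ eps.
  rewrite -[LHS]conv1l -(conv_antipodel tau_comonoid_mor) -convA.
  by rewrite -tau_conv.
by rewrite -[LHS]conv1l -(conv_antipoder hs) -convA e conv1r.
Qed.

Variables (X Y : C) (j : Hom Y (H ⊗ X)).

Lemma free_coinv_factor :
  free_coact X delta ∘ j = (eta ▷ (H ⊗ X)) ∘ luni' (H ⊗ X) ∘ j ->
  j = (eta ▷ X) ∘ luni' X ∘ (luni X ∘ (eps ▷ X) ∘ j).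
Proof.
move=> hj; set t := luni X ∘ (eps ▷ X).
have ht : (H ◁ t) ∘ free_coact X delta = idm (H ⊗ X).
  by apply: (lifts_eq (X := X) (comonoid_counitr com));
    rewrite /free_coact /t; lifts.
rewrite -{1}(comp_idl j) -ht -comp_assoc hj !comp_assoc.
by rewrite -whisk_exchange -(comp_assoc _ (𝟙 ◁ t)) -luni'_natural !comp_assoc.
Qed.

Lemma free_act_unit (m : Hom (H ⊗ H) H) (k : Hom H H) :
  free_act X m ∘ (k ⊠ ((eta ▷ X) ∘ luni' X))
  = (m ∘ (k ⊠ eta) ∘ runi' H) ▷ X.
Proof.
apply: heq_eq.
suff : lifts X (m ∘ (k ⊠ eta) ∘ runi' H)
  (free_act X m ∘ (k ⊠ ((eta ▷ X) ∘ luni' X))) by [].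
by rewrite /free_act; lifts.
Qed.

Lemma free_coinv :
  free_coact X delta ∘ j = (eta ▷ (H ⊗ X)) ∘ luni' (H ⊗ X) ∘ j ->
  free_act X mu1 ∘ (sigma ⊠ j) = free_act X mu2 ∘ (H ◁ j).
Proof.
move=> /free_coinv_factor ->; set t := luni X ∘ _ ∘ j.
have -> : sigma ⊠ ((eta ▷ X) ∘ luni' X ∘ t)
    = (sigma ⊠ ((eta ▷ X) ∘ luni' X)) ∘ (H ◁ t).
  by rewrite -tensm_comp comp_idr.
rewrite whisk_comp !comp_assoc !free_act_unit.
have -> : mu1 ∘ (sigma ⊠ eta) ∘ runi' H = sigma.
  rewrite -{1}(comp_idl sigma) -{1}(comp_idr eta) tensm_comp.
  rewrite -2!comp_assoc -runi'_natural !comp_assoc.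
  by rewrite (monoid_unitr mon) comp_idl.
by rewrite -/tau tau_sigma.
Qed.

End TrussFacts.

(** * The category of Hopf modules over a Hopf truss *)

Section HopfModCategory.
Variables (C : strict_braided_monoidal) (E : has_equalizers C).
Variable H : hopf_truss C.

Lemma truss_hopf_hom_eq (M N : truss_hopf_module E H)
  (f g : truss_hopf_hom M N) : hm_map f = hm_map g -> f = g.
Proof.
case: f g => f f1 f2 f3 [g g1 g2 g3] /= e; destruct e.
by rewrite (proof_irrelevance _ f1 g1) (proof_irrelevance _ f2 g2)
  (proof_irrelevance _ f3 g3).
Qed.

Section HopfModId.
Variable M : truss_hopf_module E H.

Lemma hm_id_act (psi : Hom (H ⊗ M) M) :
  idm (hm_ob M) ∘ psi = psi ∘ (H ◁ idm (hm_ob M)).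
Proof. by rewrite tensm_id comp_idl comp_idr. Qed.

Lemma hm_id_coact :
  hm_coact M ∘ idm (hm_ob M) = (H ◁ idm (hm_ob M)) ∘ hm_coact M.
Proof. by rewrite tensm_id comp_idl comp_idr. Qed.

Definition hm_id : truss_hopf_hom M M :=
  TrussHopfHom (hm_id_act (hm_act1 M)) (hm_id_act (hm_act2 M)) hm_id_coact.
End HopfModId.

Section HopfModComp.
Variables M N P : truss_hopf_module E H.
Variables (g : truss_hopf_hom N P) (f : truss_hopf_hom M N).

Lemma hm_comp_act1 : (hm_map g ∘ hm_map f) ∘ hm_act1 M
  = hm_act1 P ∘ (H ◁ (hm_map g ∘ hm_map f)).
Proof.
rewrite whisk_comp.
by rewrite -comp_assoc hm_map_act1 comp_assoc hm_map_act1 -comp_assoc.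
Qed.

Lemma hm_comp_act2 : (hm_map g ∘ hm_map f) ∘ hm_act2 M
  = hm_act2 P ∘ (H ◁ (hm_map g ∘ hm_map f)).
Proof.
rewrite whisk_comp.
by rewrite -comp_assoc hm_map_act2 comp_assoc hm_map_act2 -comp_assoc.
Qed.

Lemma hm_comp_coact : hm_coact P ∘ (hm_map g ∘ hm_map f)
  = (H ◁ (hm_map g ∘ hm_map f)) ∘ hm_coact M.
Proof.
rewrite whisk_comp.
by rewrite comp_assoc hm_map_coact -comp_assoc hm_map_coact comp_assoc.
Qed.

Definition hm_comp : truss_hopf_hom M P :=
  TrussHopfHom hm_comp_act1 hm_comp_act2 hm_comp_coact.
End HopfModComp.

Lemma hm_comp_idl M N (f : truss_hopf_hom M N) : hm_comp (hm_id N) f = f.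
Proof. exact/truss_hopf_hom_eq/comp_idl. Qed.

Lemma hm_comp_idr M N (f : truss_hopf_hom M N) : hm_comp f (hm_id M) = f.
Proof. exact/truss_hopf_hom_eq/comp_idr. Qed.

Lemma hm_comp_assoc M N P Q (h : truss_hopf_hom P Q) (g : truss_hopf_hom N P)
    (f : truss_hopf_hom M N) :
  hm_comp h (hm_comp g f) = hm_comp (hm_comp h g) f.
Proof. exact/truss_hopf_hom_eq/comp_assoc. Qed.

(** The category of left Hopf modules over [H]. *)
Definition hopf_mod : category :=
  Category hm_comp_idl hm_comp_idr hm_comp_assoc.

(** * The induction functor and the functor of coinvariants *)

Section InductionOb.
Variable X : C.

Lemma free_is_truss_module :
  is_truss_module (free_act X (t_mu1 H)) (free_act X (t_mu2 H)).
Proof.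
split.
- exact/free_module/(bimonoid_monoid (hopf_bimonoid (truss_H1 H))).
- exact/free_nonunital_module/(nubimonoid_assoc (truss_H2 H)).
- exact/free_truss_law/(truss_compat H).
Qed.

Lemma free_is_hopf1 : is_hopf_module (t_eta H) (t_mu1 H) (t_eps H) (t_delta H)
  (free_act X (t_mu1 H)) (free_coact X (t_delta H)).
Proof.
have [hm hc _ hd] := hopf_bimonoid (truss_H1 H).
by split; [apply: free_module | apply: free_comodule | apply: free_compat hd].
Qed.

Lemma free_is_hopf2 : is_nonunital_hopf_module (t_mu2 H) (t_eps H) (t_delta H)
  (free_act X (t_mu2 H)) (free_coact X (t_delta H)).
Proof.
have [hm hc hd] := truss_H2 H.
by split; [apply: free_nonunital_module | apply: free_comodule
  | apply: free_compat hd].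
Qed.

Lemma free_is_coinv (j := equ_mor (coinv E (free_coact X (t_delta H)))) :
  free_act X (t_mu1 H) ∘ (t_sigma H ⊠ j) = free_act X (t_mu2 H) ∘ (H ◁ j).
Proof. exact/free_coinv/equ_eq. Qed.

Definition induction_ob : truss_hopf_module E H :=
  TrussHopfModule free_is_truss_module free_is_hopf1 free_is_hopf2
    free_is_coinv.
End InductionOb.

Section InductionMap.
Variables (X Y : C) (f : Hom X Y).

Lemma free_act_natural (m : Hom (H ⊗ H) H) :
  (H ◁ f) ∘ free_act X m = free_act Y m ∘ (H ◁ H ◁ f).
Proof.
rewrite /free_act comp_assoc -whisk_exchange -[RHS]comp_assoc.
by rewrite asso'_natural tensm_id !comp_assoc.
Qed.

Lemma free_coact_natural :
  free_coact Y (t_delta H) ∘ (H ◁ f)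
  = (H ◁ H ◁ f) ∘ free_coact X (t_delta H).
Proof.
rewrite /free_coact -comp_assoc whisk_exchange comp_assoc -(tensm_id H H).
by rewrite asso_natural comp_assoc.
Qed.

Definition induction_map :
    truss_hopf_hom (induction_ob X) (induction_ob Y) :=
  @TrussHopfHom C E H (induction_ob X) (induction_ob Y) (H ◁ f)
    (free_act_natural (t_mu1 H)) (free_act_natural (t_mu2 H))
    free_coact_natural.
End InductionMap.

Lemma induction_id X : induction_map (idm X) = hm_id (induction_ob X).
Proof. exact/truss_hopf_hom_eq/tensm_id. Qed.

Lemma induction_comp X Y Z (g : Hom Y Z) (f : Hom X Y) :
  induction_map (g ∘ f) = hm_comp (induction_map g) (induction_map f).
Proof. exact/truss_hopf_hom_eq/whisk_comp. Qed.

Definition induction : functor C hopf_mod :=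
  @Functor C hopf_mod induction_ob induction_map induction_id induction_comp.

Definition coinv_ob (M : truss_hopf_module E H) : C :=
  equ_ob (coinv E (hm_coact M)).

Definition coinv_incl (M : truss_hopf_module E H) :
    Hom (coinv_ob M) (hm_ob M) :=
  equ_mor (coinv E (hm_coact M)).

Lemma coinv_map_eq M N (f : truss_hopf_hom M N) :
  hm_coact N ∘ (hm_map f ∘ coinv_incl M)
  = (t_eta H ▷ N) ∘ luni' N ∘ (hm_map f ∘ coinv_incl M).
Proof.
rewrite comp_assoc hm_map_coact -comp_assoc equ_eq !comp_assoc.
by rewrite -whisk_exchange -(comp_assoc _ (luni' N)) luni'_natural !comp_assoc.
Qed.

Definition coinv_map M N (f : truss_hopf_hom M N) :
    Hom (coinv_ob M) (coinv_ob N) :=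
  equ_lift (coinv E (hm_coact N)) (coinv_map_eq f).

Lemma coinv_mapK M N (f : truss_hopf_hom M N) :
  coinv_incl N ∘ coinv_map f = hm_map f ∘ coinv_incl M.
Proof. exact: equ_liftK. Qed.

Lemma coinv_map_id M : coinv_map (hm_id M) = idm (coinv_ob M).
Proof.
by apply: equ_mono; rewrite coinv_mapK comp_idl comp_idr.
Qed.

Lemma coinv_map_comp M N P (g : truss_hopf_hom N P) (f : truss_hopf_hom M N) :
  coinv_map (hm_comp g f) = coinv_map g ∘ coinv_map f.
Proof.
apply: equ_mono; rewrite coinv_mapK comp_assoc coinv_mapK.
by rewrite -comp_assoc coinv_mapK comp_assoc.
Qed.

Definition coinvariants : functor hopf_mod C :=
  @Functor hopf_mod C coinv_ob coinv_map coinv_map_id coinv_map_comp.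

End HopfModCategory.

(* Main.v *)
(** The counit at [M] is [ψ¹ ∘ (H ⊗ j_M)] and the unit at [X] is [η ⊗ X].
    Condition (iv) turns [Γ_M ∘ (H ⊗ j_M)] into [((λ ∘ σ) * σ) · j_M = ε ⊗ j_M],
    whence the counit is linear for the second actions.  The inverse of the
    counit is [(H ⊗ p) ∘ ρ], where [j_M ∘ p = q] and [q = ψ¹ ∘ (λ ⊗ M) ∘ ρ].
    That [q] has coinvariant values follows from the expression
    [ρ m = m_(-1) · (1 ⊗ q m_(0))] in the diagonal action on [H ⊗ M]: letting
    [λ] of a further coproduct factor act on it cancels [m_(-1)]. *)
From Corelib Require Import ssreflect.
Require Import Defs.

Set Implicit Arguments.
Unset Strict Implicit.
Unset Printing Implicit Defensive.

Local Open Scope cat_scope.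

(** * The braiding with the unit object on the left *)

Section BraidUnit.
Variable C : strict_braided_monoidal.
Implicit Types A D E : C.

Lemma braid_unitl A : braid 𝟙 A = runi' A ∘ luni A.
Proof.
pose c := runi A ∘ braid 𝟙 A ∘ luni' A.
have hc : heq c (braid 𝟙 A) by apply/heq_castr/heq_castl/heq_refl.
(* The hexagon makes the invertible morphism [c] idempotent. *)
have cc : c ∘ c = c.
  apply: heq_eq; apply: heq_trans (heq_sym hc).
  apply: heq_trans (heq_braid (tens1l 𝟙) (eq_refl A)).
  rewrite braid_hexr; apply/heq_sym/heq_castr; apply: heq_comp.
    apply/heq_castr/heq_castl; apply: heq_trans (heq_tens1r _) _.
    exact: heq_sym.
  by apply: heq_trans (heq_tens1l _) _; apply: heq_sym.
have [d [dl _]] := braid_iso 𝟙 A.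
have c1 : c = idm A.
  have e : (luni A ∘ d ∘ runi' A) ∘ c = idm A.
    rewrite /c !comp_assoc -(comp_assoc _ (runi' A)) runiK comp_idr.
    by rewrite -(comp_assoc _ d) dl comp_idr luni'K.
  by rewrite -{1}(comp_idl c) -e -comp_assoc cc.
have -> : braid 𝟙 A = runi' A ∘ c ∘ luni A.
  by rewrite /c !comp_assoc runiK comp_idl -comp_assoc luniK comp_idr.
by rewrite c1 comp_idr.
Qed.

(** Once a counit has reduced the second leg to [𝟙], the braiding is structural and can be discarded
    by [eqhom_irr]. *)
Lemma braid_mid_unitl A D E : exists e, braid_mid A 𝟙 D E = eqhom e.
Proof.
rewrite /braid_mid braid_unitl /luni /runi' eqhom_comp.
have [e1 ->] := eqhom_tens (eq_trans (tens1l D) (eq_sym (tens1r D)))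
  (eq_refl E).
rewrite /asso /asso' !eqhom_comp.
set e2 := eq_trans _ (eq_trans _ _).
have [e3 ->] := eqhom_tens (eq_refl A) e2.
rewrite !eqhom_comp; by eexists.
Qed.

End BraidUnit.

(** * Convolution acting on modules over [H_1] *)

Section HopfModules.
Variables (C : strict_braided_monoidal) (H : hopf_truss C).

Notation eps := (t_eps H).
Notation delta := (t_delta H).
Notation eta := (t_eta H).
Notation mu1 := (t_mu1 H).
Notation mu2 := (t_mu2 H).
Notation lambda := (t_lambda H).
Notation sigma := (t_sigma H).

Let bim := hopf_bimonoid (truss_H1 H).
Let mon := bimonoid_monoid bim.
Let com := bimonoid_comonoid bim.

Lemma counitr_comult : (H ◁ eps) ∘ delta = runi' H.
Proof.
rewrite -[LHS]comp_idl -runiK -comp_assoc (comp_assoc (runi _)).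
by rewrite (comonoid_counitr com) comp_idr.
Qed.

Lemma free_coact_counit X :
  (H ◁ (luni X ∘ (eps ▷ X))) ∘ free_coact X delta = idm (H ⊗ X).
Proof.
by apply: (lifts_eq (X := X) (comonoid_counitr com));
  rewrite /free_coact; lifts.
Qed.

(** This is grouplikeness of [eta] tensored with [X]; it lets [η ⊗ X] factor through the
    coinvariants of [H ⊗ X]. *)
Lemma free_coact_unit X :
  free_coact X delta ∘ ((eta ▷ X) ∘ luni' X)
  = (eta ▷ (H ⊗ X)) ∘ luni' (H ⊗ X) ∘ ((eta ▷ X) ∘ luni' X).
Proof.
have e : delta ∘ eta = (eta ▷ H) ∘ luni' H ∘ eta.
  rewrite (comonoid_mor_comult (bimonoid_unit_comor bim)) /unit_comult.
  rewrite -(comp_assoc _ (luni' H)) luni'_natural comp_assoc.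
  by rewrite -tensm_comp comp_idl comp_idr.
have r : lifts X ((eta ▷ H) ∘ luni' H) ((eta ▷ (H ⊗ X)) ∘ luni' (H ⊗ X)).
  by apply/lifts_castr/lifts_castr'; rewrite -tensm_id; apply/heq_sym/heq_tensA.
rewrite !comp_assoc; congr (_ ∘ _).
apply: (lifts_eq (X := X) e); first by rewrite /free_coact; lifts.
exact: lifts_comp r (lifts_base _ _).
Qed.

Section Module.
Variables (M : C) (psi : Hom (H ⊗ M) M).
Hypothesis hpsi : is_module eta mu1 psi.

(** Associativity of the action merges the two successive actions. Every later cancellation by the
    antipode goes through this lemma; a general [j] allows its use on coinvariants too. *)
Lemma module_conv Y (j : Hom Y M) (f g : Hom H H) :
  psi ∘ (f ⊠ (psi ∘ (g ⊠ j))) ∘ asso H H Y ∘ (delta ▷ Y)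
  = psi ∘ (conv f g ⊠ j).
Proof.
have -> : f ⊠ (psi ∘ (g ⊠ j)) = (H ◁ psi) ∘ (f ⊠ g ⊠ j).
  by rewrite -tensm_comp comp_idl.
rewrite !comp_assoc -(comp_assoc _ _ (asso _ _ _)) -asso_natural !comp_assoc.
rewrite (module_assoc hpsi) -2!(comp_assoc psi) -!tensm_comp.
by rewrite comp_idl comp_idr.
Qed.

Lemma module_counit Y (j : Hom Y M) :
  psi ∘ ((eta ∘ eps) ⊠ j) = j ∘ luni Y ∘ (eps ▷ Y).
Proof.
have -> : (eta ∘ eps) ⊠ j = (eta ▷ M) ∘ (𝟙 ◁ j) ∘ (eps ▷ Y).
  by rewrite -!tensm_comp !comp_idr !comp_idl.
rewrite !comp_assoc; congr (_ ∘ _).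
rewrite -[LHS]comp_idr -luniK comp_assoc -(comp_assoc _ _ (luni' Y)).
rewrite -luni'_natural !comp_assoc (module_unit hpsi).
by rewrite comp_idl.
Qed.

(** * The projection onto the coinvariants *)

Section Coaction.
Variable rho : Hom M (H ⊗ M).
Hypothesis hrho : is_comodule eps delta rho.

Lemma comodule_conv (f g : Hom H H) :
  psi ∘ (f ⊠ (psi ∘ (g ▷ M) ∘ rho)) ∘ rho = psi ∘ (conv f g ▷ M) ∘ rho.
Proof.
have -> : f ⊠ (psi ∘ (g ▷ M) ∘ rho) = (f ⊠ (psi ∘ (g ▷ M))) ∘ (H ◁ rho).
  by rewrite -tensm_comp comp_idr.
rewrite -module_conv !comp_assoc -(comp_assoc _ (_ ◁ _) rho).
by rewrite -(comodule_coassoc hrho) !comp_assoc.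
Qed.

Lemma comodule_conv_unit : psi ∘ ((eta ∘ eps) ▷ M) ∘ rho = idm M.
Proof.
by rewrite module_counit comp_idl (comodule_counit hrho).
Qed.

Definition coinv_proj : Hom M M := psi ∘ (lambda ▷ M) ∘ rho.

(** By [comodule_conv] the left side is the action of [id * λ = η ∘ ε]. It makes the counit of the
    adjunction split. *)
Lemma coinv_projK : psi ∘ (H ◁ coinv_proj) ∘ rho = idm M.
Proof.
rewrite comodule_conv -[RHS]comodule_conv_unit /conv.
by rewrite (hopf_antipoder (truss_H1 H)).
Qed.

Hypothesis hcompat : hopf_compat mu1 delta psi rho.

Definition diag_act : Hom (H ⊗ H ⊗ M) (H ⊗ M) :=
  (mu1 ⊠ psi) ∘ braid_mid H H H M ∘ (delta ▷ (H ⊗ M)).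
(** In elements [h ⊗ m ↦ h_1 ⊗ h_2 m]: the diagonal action of [h] on [1 ⊗ m]. *)
Definition comult_act : Hom (H ⊗ M) (H ⊗ M) :=
  (H ◁ psi) ∘ free_coact M delta.

(** Replaces associativity of the diagonal action, so that neither the
    hexagons nor anticomultiplicativity of [lambda] are needed. *)
Lemma diag_act_comult_act :
  diag_act ∘ (H ◁ comult_act) = comult_act ∘ free_act M mu1.
Proof.
have hc := free_compat M (bimonoid_mul_comor bim).
rewrite {2}/comult_act -comp_assoc hc.
rewrite /diag_act /comult_act -(comp_assoc _ (delta ▷ _)) -tensm_comp.
rewrite comp_idl comp_idr.
have -> : delta ⊠ ((H ◁ psi) ∘ free_coact M delta)
    = ((H ◁ idm H) ⊠ (H ◁ psi)) ∘ (delta ⊠ free_coact M delta).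
  by rewrite -tensm_comp tensm_id comp_idl.
rewrite [LHS]comp_assoc -(comp_assoc _ (braid_mid _ _ _ _)) braid_mid_natural.
rewrite [RHS]comp_assoc; congr (_ ∘ _).
rewrite [LHS]comp_assoc [RHS]comp_assoc; congr (_ ∘ _).
rewrite -!tensm_comp tensm_id comp_idr comp_idl; congr (_ ⊠ _).
rewrite /free_act comp_assoc -(module_assoc hpsi).
by rewrite -comp_assoc eqhomK comp_idr.
Qed.

Lemma comult_act_unit :
  comult_act ∘ ((eta ▷ M) ∘ luni' M) = (eta ▷ M) ∘ luni' M.
Proof.
rewrite /comult_act -comp_assoc free_coact_unit !comp_assoc.
rewrite -whisk_exchange -(comp_assoc _ _ (luni' (H ⊗ M))) -luni'_natural.
rewrite !comp_assoc -(comp_assoc _ psi) -(comp_assoc _ _ (luni' M)).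
by rewrite (module_unit hpsi) comp_idr.
Qed.

(** Coassociativity moves the coproduct onto a second [rho], where [coinv_projK] applies. *)
Lemma coact_coinv_proj : rho = comult_act ∘ (H ◁ coinv_proj) ∘ rho.
Proof.
rewrite /comult_act /free_coact !comp_assoc.
rewrite -(comp_assoc _ (delta ▷ M)) whisk_exchange -(tensm_id H H).
rewrite comp_assoc -(comp_assoc _ (asso _ _ _)) asso_natural comp_assoc.
rewrite -2![RHS]comp_assoc (comp_assoc (asso _ _ _)).
rewrite (comodule_coassoc hrho) !comp_assoc -!whisk_comp.
by rewrite coinv_projK tensm_id comp_idl.
Qed.

Lemma coinv_proj_coinv :
  rho ∘ coinv_proj = (eta ▷ M) ∘ luni' M ∘ coinv_proj.
Proof.
(* The Hopf module condition, read as linearity of [rho] for the diagonal action. *)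
have hD : rho ∘ psi = diag_act ∘ (H ◁ rho).
  rewrite hcompat /diag_act -[RHS]comp_assoc -tensm_comp.
  by rewrite comp_idl comp_idr.
have -> : rho ∘ coinv_proj
    = diag_act ∘ (H ◁ comult_act) ∘ (lambda ⊠ ((H ◁ coinv_proj) ∘ rho)) ∘ rho.
  rewrite -(comp_assoc _ _ (lambda ⊠ _)) -tensm_comp comp_idl.
  rewrite (comp_assoc comult_act) -coact_coinv_proj /coinv_proj.
  rewrite !comp_assoc hD -(comp_assoc _ _ (lambda ▷ M)) -tensm_comp.
  by rewrite comp_idl comp_idr.
rewrite diag_act_comult_act.
(* By coassociativity [λ] and the next coproduct leg meet under [mu1], so that the antipode law
   applies. *)
transitivity
  (comult_act ∘ ((mu1 ∘ (lambda ▷ H) ∘ delta) ⊠ coinv_proj) ∘ rho).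
  have -> : lambda ⊠ ((H ◁ coinv_proj) ∘ rho)
      = (lambda ⊠ (H ◁ coinv_proj)) ∘ (H ◁ rho).
    by rewrite -tensm_comp comp_idr.
  rewrite !comp_assoc -(comp_assoc _ (H ◁ rho)) -(comodule_coassoc hrho).
  rewrite /free_act !comp_assoc -(comp_assoc _ (asso' _ _ _)) asso'_natural.
  rewrite !comp_assoc -(comp_assoc _ (asso' _ _ _)) eqhomK comp_idr.
  by rewrite -2!(comp_assoc comult_act) -!tensm_comp !comp_idl comp_idr.
rewrite (hopf_antipodel (truss_H1 H)).
have -> : (eta ∘ eps) ⊠ coinv_proj
    = (eta ▷ M) ∘ ((𝟙 ◁ coinv_proj) ∘ (eps ▷ M)).
  by rewrite -!tensm_comp !comp_idr !comp_idl.
have e : (eps ▷ M) ∘ rho = luni' M.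
  rewrite -[LHS]comp_idl -luniK -comp_assoc (comp_assoc (luni _)).
  by rewrite (comodule_counit hrho) comp_idr.
rewrite -2!comp_assoc -(comp_assoc (𝟙 ◁ _)) e -luni'_natural.
by rewrite (comp_assoc (eta ▷ M)) comp_assoc comult_act_unit.
Qed.

(** * The action of [H_1] on coinvariant elements *)

Variables (Y : C) (j : Hom Y M).
Hypothesis hj : rho ∘ j = (eta ▷ M) ∘ luni' M ∘ j.

(** Coinvariance replaces [rho ∘ j] by [η ⊗ j], so the Hopf module condition only coacts on the
    factor [H]; the braiding meets [𝟙] and becomes structural. *)
Lemma act_coinv_coact :
  rho ∘ (psi ∘ (H ◁ j)) = (H ◁ (psi ∘ (H ◁ j))) ∘ free_coact Y delta.
Proof.
have hr : mu1 ∘ (H ◁ eta) = runi H.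
  rewrite -[LHS]comp_idr -runiK -[RHS]comp_idl.
  by rewrite -[X in _ = X ∘ _](monoid_unitr mon) !comp_assoc.
(* Both sides will start with this factor; cancelling it and [delta ▷ Y] leaves only structural
   identities. *)
have -> : (H ◁ (psi ∘ (H ◁ j))) = (idm H ∘ idm H) ⊠ (psi ∘ (H ◁ j)).
  by rewrite comp_idl.
rewrite comp_assoc hcompat -(comp_assoc _ (delta ⊠ rho)) -tensm_comp hj.
have -> : (delta ∘ idm H) ⊠ ((eta ▷ M) ∘ luni' M ∘ j)
    = ((H ◁ idm H) ⊠ (eta ⊠ j)) ∘ (delta ⊠ luni' Y).
  rewrite -tensm_comp tensm_id comp_idl comp_idr -comp_assoc luni'_natural.
  by rewrite comp_assoc -tensm_comp comp_idl comp_idr.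
rewrite [LHS]comp_assoc -(comp_assoc _ (braid_mid _ _ _ _)) braid_mid_natural.
have [e1 ->] := braid_mid_unit H (H : C) Y.
rewrite [X in X ∘ _ = _]comp_assoc -tensm_comp hr.
have -> : runi H ⊠ (psi ∘ (H ◁ j))
    = ((idm H ∘ idm H) ⊠ (psi ∘ (H ◁ j))) ∘ (runi H ▷ (H ⊗ Y)).
  by rewrite -tensm_comp !comp_idl comp_idr.
have -> : delta ⊠ luni' Y = ((H ⊗ H) ◁ luni' Y) ∘ (delta ▷ Y).
  by rewrite -tensm_comp comp_idl comp_idr.
rewrite /free_coact /runi /luni' /asso.
have [e2 ->] := eqhom_tens (tens1r (H : C)) (eq_refl (H ⊗ Y)).
have [e3 ->] := eqhom_tens (eq_refl (H ⊗ H)) (eq_sym (tens1l Y)).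
rewrite [LHS]comp_assoc [RHS]comp_assoc; congr (_ ∘ _).
rewrite -2!comp_assoc; congr (_ ∘ _).
by rewrite !eqhom_comp; apply: eqhom_irr.
Qed.

(** By [act_coinv_coact] the left side is [λ * id = η ∘ ε] acting on [j]. *)
Lemma coinv_proj_act :
  coinv_proj ∘ (psi ∘ (H ◁ j)) = j ∘ luni Y ∘ (eps ▷ Y).
Proof.
rewrite /coinv_proj -(comp_assoc _ rho) act_coinv_coact /free_coact.
rewrite !comp_assoc -(comp_assoc psi) -tensm_comp comp_idl comp_idr.
by rewrite module_conv /conv (hopf_antipodel (truss_H1 H)) module_counit.
Qed.

End Coaction.

End Module.

(** * Linearity of the counit for the second actions *)

Section SecondAction.
Variables (M Y : C) (psi1 psi2 : Hom (H ⊗ M) M) (j : Hom Y M).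
Hypothesis hM : is_truss_module psi1 psi2.
Hypothesis hj : psi1 ∘ (sigma ⊠ j) = psi2 ∘ (H ◁ j).

(** As [sigma] is a comonoid morphism, [λ ∘ σ] is its convolution inverse. *)
Lemma Gamma_coinv :
  Gamma delta lambda sigma psi1 psi2 ∘ (H ◁ j) = j ∘ luni Y ∘ (eps ▷ Y).
Proof.
have h1 := truss_module_act1 hM.
rewrite /Gamma -comp_assoc whisk_exchange -(tensm_id H H) comp_assoc.
rewrite -(comp_assoc _ (asso _ _ _)) asso_natural comp_assoc.
rewrite -(comp_assoc psi1) -tensm_comp comp_idr -hj module_conv //.
by rewrite (conv_antipodel (truss_sigma_comor H)) module_counit.
Qed.

(** With [∘] for [mu2], the truss law sends [h ⊗ k ⊗ y] to [(h_1 ∘ k) · Γ(h_2 ⊗ j y)], which is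
    [(h_1 ∘ k) ε(h_2) · j y] by [Gamma_coinv]. *)
Lemma act_coinv_act2 :
  (psi1 ∘ (H ◁ j)) ∘ free_act Y mu2 = psi2 ∘ (H ◁ (psi1 ∘ (H ◁ j))).
Proof.
rewrite whisk_comp comp_assoc (truss_module_law hM).
rewrite -[RHS]comp_assoc whisk_exchange -(tensm_id H H).
rewrite comp_assoc -(comp_assoc _ (braid_mid _ _ _ _)) braid_mid_natural.
rewrite [X in _ = X ∘ _]comp_assoc -(comp_assoc psi1 (mu2 ⊠ _)) -tensm_comp.
rewrite Gamma_coinv tensm_id comp_idr.
have -> : mu2 ⊠ (j ∘ luni Y ∘ (eps ▷ Y))
    = (H ◁ j) ∘ (mu2 ▷ Y) ∘ ((H ⊗ H) ◁ luni Y) ∘ ((H ◁ idm H) ⊠ (eps ▷ Y)).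
  by rewrite -!tensm_comp tensm_id !comp_idl !comp_idr.
(* The counit is moved before the braiding, where it cancels [delta]. *)
rewrite -(comp_assoc psi1 _ (braid_mid _ _ _ _)).
rewrite -(comp_assoc _ _ (braid_mid _ _ _ _)) -braid_mid_natural.
have [e1 ->] := braid_mid_unitl H (H : C) Y.
rewrite !comp_assoc -(comp_assoc _ _ (delta ▷ _)).
rewrite -tensm_comp counitr_comult tensm_id comp_idl.
rewrite /runi' /luni.
have [e2 ->] := eqhom_tens (eq_sym (tens1r (H : C))) (eq_refl (H ⊗ Y)).
have [e3 ->] := eqhom_tens (eq_refl (H ⊗ H)) (tens1l Y).
rewrite /free_act -!(comp_assoc (psi1 ∘ _)) -!(comp_assoc (mu2 ▷ Y)).
by rewrite !eqhom_comp; congr (_ ∘ (_ ∘ _)); apply: eqhom_irr.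
Qed.

End SecondAction.

End HopfModules.

(** * The adjunction and its invertible unit and counit *)

Section Adjunction.
Variables (C : strict_braided_monoidal) (E : has_equalizers C).
Variable H : hopf_truss C.

Let mon := bimonoid_monoid (hopf_bimonoid (truss_H1 H)).

(** The squares expressing linearity and colinearity can be inverted, so the counit needs an inverse
    in [C] only. *)
Lemma hopf_mod_iso (M N : hopf_mod E H) (f : Hom M N) :
  is_iso (hm_map f) -> is_iso f.
Proof.
move=> [g [gf fg]].
have inv_act (a : Hom (H ⊗ hm_ob M) (hm_ob M))
    (b : Hom (H ⊗ hm_ob N) (hm_ob N)) :
    hm_map f ∘ a = b ∘ (H ◁ hm_map f) -> g ∘ b = a ∘ (H ◁ g).
  move=> h; rewrite -[b]comp_idr -tensm_id -fg whisk_comp (comp_assoc b) -h.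
  by rewrite !comp_assoc gf comp_idl.
have inv_coact : hm_coact M ∘ g = (H ◁ g) ∘ hm_coact N.
  rewrite -[hm_coact N]comp_idr -fg (comp_assoc (hm_coact N)) hm_map_coact.
  by rewrite !comp_assoc -whisk_comp gf tensm_id comp_idl.
exists (TrussHopfHom (inv_act _ _ (hm_map_act1 f))
  (inv_act _ _ (hm_map_act2 f)) inv_coact).
by split; apply: truss_hopf_hom_eq.
Qed.

Section Counit.
Variable M : truss_hopf_module E H.

Notation j := (coinv_incl M).
Notation act := (hm_act1 M).

Let hact : is_module (t_eta H) (t_mu1 H) act :=
  hopf_module_module (hm_hopf1 M).
Let hcoact : is_comodule (t_eps H) (t_delta H) (hm_coact M) :=
  hopf_module_comodule (hm_hopf1 M).
Let hcompat : hopf_compat (t_mu1 H) (t_delta H) act (hm_coact M) :=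
  hopf_module_compat (hm_hopf1 M).
Let hj : hm_coact M ∘ j = (t_eta H ▷ M) ∘ luni' M ∘ j :=
  equ_eq (coinv E (hm_coact M)).

Lemma counit_act1 :
  (act ∘ (H ◁ j)) ∘ free_act (coinv_ob M) (t_mu1 H)
  = act ∘ (H ◁ (act ∘ (H ◁ j))).
Proof.
rewrite whisk_comp comp_assoc -[act ∘ _ in RHS]comp_idr.
rewrite -(eqhomK (eq_sym (tensA (H : C) H M)) (tensA (H : C) H M)).
rewrite comp_assoc (module_assoc hact) -[RHS]comp_assoc asso'_natural.
rewrite /free_act !comp_assoc; congr (_ ∘ _).
by rewrite -(comp_assoc _ (H ◁ j)) -whisk_exchange tensm_id comp_assoc.
Qed.

Definition counit_hom :
    truss_hopf_hom (induction_ob E H (coinv_ob M)) M :=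
  @TrussHopfHom C E H (induction_ob E H (coinv_ob M)) M (act ∘ (H ◁ j))
    counit_act1 (act_coinv_act2 (hm_module M) (hm_coinv M))
    (act_coinv_coact hcompat hj).

Lemma counit_iso : is_iso (act ∘ (H ◁ j)).
Proof.
pose p := equ_lift (coinv E (hm_coact M))
  (coinv_proj_coinv hact hcoact hcompat).
have hp : j ∘ p = coinv_proj act (hm_coact M) by apply: equ_liftK.
exists ((H ◁ p) ∘ hm_coact M); split; last first.
  rewrite comp_assoc -(comp_assoc act) -whisk_comp hp.
  exact: coinv_projK.
rewrite -comp_assoc (act_coinv_coact hcompat hj) comp_assoc -whisk_comp.
(* Checked after the monomorphism [j], where [p] becomes [coinv_proj]. *)
have -> : p ∘ (act ∘ (H ◁ j)) = luni _ ∘ (t_eps H ▷ coinv_ob M).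
  apply: (@equ_mono _ _ _ _ _ (coinv E (hm_coact M))).
  by rewrite !(comp_assoc j) -!comp_assoc (comp_assoc _ p) hp
    coinv_proj_act // !comp_assoc.
exact: free_coact_counit.
Qed.

End Counit.

Section Unit.
Variable X : C.

Notation incl := (coinv_incl (induction_ob E H X)).

Definition unit_hom : Hom X (coinv_ob (induction_ob E H X)) :=
  equ_lift (coinv E (free_coact X (t_delta H))) (free_coact_unit H X).

Lemma unit_homK : incl ∘ unit_hom = (t_eta H ▷ X) ∘ luni' X.
Proof. exact: equ_liftK. Qed.

Lemma unit_iso : is_iso unit_hom.
Proof.
have [he _] := bimonoid_unit_comor (hopf_bimonoid (truss_H1 H)).
(* One composite is [ε ∘ η = id]; for the other, [free_coinv_factor] shows that coinvariants of
   [H ⊗ X] factor through [η ⊗ X]. *)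
exists (luni X ∘ (t_eps H ▷ X) ∘ incl); split.
  rewrite -comp_assoc unit_homK comp_assoc -(comp_assoc (luni X)).
  by rewrite -tensm_comp he comp_idl tensm_id comp_idr luni'K.
have e : incl ∘ (unit_hom ∘ (luni X ∘ (t_eps H ▷ X) ∘ incl)) = incl.
  by rewrite comp_assoc unit_homK -free_coinv_factor //; apply: equ_eq.
apply: (@equ_mono _ _ _ _ _ (coinv E (free_coact X (t_delta H)))).
by rewrite comp_idr; exact: e.
Qed.

End Unit.

Lemma unit_natural X X' (f : Hom X X') :
  coinv_map (induction_map E H f) ∘ unit_hom X = unit_hom X' ∘ f.
Proof.
apply: equ_mono; rewrite !comp_assoc coinv_mapK unit_homK.
rewrite -comp_assoc unit_homK -comp_assoc luni'_natural !comp_assoc.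
by rewrite -whisk_exchange.
Qed.

Lemma counit_natural M N (f : truss_hopf_hom M N) :
  hm_comp f (counit_hom M)
  = hm_comp (counit_hom N) (induction_map E H (coinv_map f)).
Proof.
apply: truss_hopf_hom_eq; rewrite /= comp_assoc hm_map_act1.
by rewrite -!comp_assoc -!whisk_comp coinv_mapK.
Qed.

Lemma triangle_l X :
  hm_comp (counit_hom (induction_ob E H X)) (induction_map E H (unit_hom X))
  = hm_id (induction_ob E H X).
Proof.
apply: truss_hopf_hom_eq; rewrite /= -comp_assoc -whisk_comp unit_homK.
by rewrite free_act_unit (monoid_unitr mon) tensm_id.
Qed.

(** After composing with [j], only the unit law of the first action remains. *)
Lemma triangle_r M :
  coinv_map (counit_hom M) ∘ unit_hom (coinv_ob M) = idm (coinv_ob M).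
Proof.
apply: equ_mono; rewrite comp_assoc coinv_mapK -comp_assoc unit_homK /=.
rewrite comp_assoc -(comp_assoc _ (H ◁ _)) -whisk_exchange.
rewrite -!comp_assoc -luni'_natural comp_idr !comp_assoc.
by rewrite (module_unit (hopf_module_module (hm_hopf1 M))) comp_idl.
Qed.

Definition hopf_mod_adjunction :
    adjunction (induction E H) (coinvariants E H) :=
  @Adjunction _ _ (induction E H) (coinvariants E H) unit_hom counit_hom
    unit_natural counit_natural triangle_l triangle_r.

End Adjunction.

Theorem theorem5p10 (C : strict_braided_monoidal) (E : has_equalizers C)
    (H : hopf_truss C) :
  exists adj : adjunction (induction E H) (coinvariants E H),
    is_adjoint_equivalence adj.
Proof.
exists (hopf_mod_adjunction E H); split=> [X | M]; first exact: unit_iso.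
exact/hopf_mod_iso/counit_iso.
Qed.
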